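(* Let $(X,\mathcal F)$ be a measurable space and let $v$ be a capacity on $\mathcal F$. Then the following two conditions are equivalent: (i) $\lim_n\int^{Cho}_X f_n\,dv=\int^{Cho}_X f\,dv$ for every increasing sequence $\{f_n\}_n\subset\mathcal M$ converging strongly $v$-a.e. to a function $f\in\mathcal M$; (ii) $v$ is continuous from below.
   Context: $\mathcal M$ is the collection of all nonnegative $\mathcal F$-measurable functions on $X$. A capacity is a finite set function $v:\mathcal F\to[0,\infty)$ with $v(\emptyset)=0$ and $v(F)\le v(E)$ whenever $F\subseteq E$ (no additivity is assumed). The Choquet integral of $f\in\mathcal M$ is $\int^{Cho}_X f\,dv:=\int_0^\infty v(\{x: f(x)\ge t\})\,dt\in[0,\infty]$ (extended Riemann integral). A sequence $\{f_n\}_n$ is increasing if $f_n\le f_{n+1}$ pointwise on $X$ for all $n$. $\{f_n\}_n$ converges to $f$ strongly $v$-a.e. if $v(\{x\in F: f_n(x)\to f(x)\})=v(F)$ for all $F\in\mathcal F$. $v$ is continuous from below if $\lim_n v(F_n)=v(\bigcup_n F_n)$ for every increasing sequence $F_1\subseteq F_2\subseteq\cdots$ in $\mathcal F$. *)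

(* Defs.v *)
From mathcomp Require Import all_boot all_order all_algebra.
From mathcomp Require Import all_classical all_reals all_analysis.
Export numFieldNormedType.Exports.

Set Implicit Arguments.
Unset Strict Implicit.
Unset Printing Implicit Defensive.

Import Order.TTheory GRing.Theory Num.Theory.

#[global] Open Scope classical_set_scope.
#[global] Open Scope ring_scope.

Section RiemannIntegral.
Context {R : realType}.
Implicit Types (g : R -> R) (a b l d : R) (s : seq R) (t : nat -> R).

(* In [itv_partition a b s] the left endpoint [a] is not listed in [s]: the
   points of the partition are [a :: s], and its cells are indexed by
   [i < size s]. *)
Definition partition_pt a s i : R := nth a (a :: s) i.

Definition mesh_lt a s d :=
  forall i, (i < size s)%N -> partition_pt a s i.+1 - partition_pt a s i < d.

Definition tagged a s t :=
  forall i, (i < size s)%N -> partition_pt a s i <= t i <= partition_pt a s i.+1.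

Definition riemann_sum g a s t : R :=
  \sum_(0 <= i < size s) g (t i) * (partition_pt a s i.+1 - partition_pt a s i).

Definition is_riemann_integral g a b l :=
  forall e : R, 0 < e -> exists2 d : R, 0 < d &
    forall s t, itv_partition a b s -> mesh_lt a s d -> tagged a s t ->
      `|riemann_sum g a s t - l| < e.

(* Meaningful only when [a <= b] and [g] is Riemann integrable on [a, b]. *)
Definition riemann_integral g a b : R :=
  get [set l | is_riemann_integral g a b l].

(* Extended Riemann integral over [0, +oo); the limit is taken in the extended
   reals, so the value [+oo] is allowed. *)
Definition ext_riemann_integral g : \bar R :=
  lim ((riemann_integral g 0 b)%:E @[b --> +oo]).

End RiemannIntegral.

Section Choquet.
Context {R : realType} {d : measure_display} {T : measurableType d}.
Implicit Types (v : set T -> R) (f : T -> R).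

Definition nonneg_measurable : set (T -> R) :=
  [set f : T -> R | measurable_fun [set: T] f /\ forall x, 0 <= f x].

(* The values of [v] on non-measurable sets are irrelevant. *)
Definition capacity v :=
  [/\ forall E, measurable E -> 0 <= v E,
      v set0 = 0 &
      forall E F, measurable E -> measurable F -> F `<=` E -> v F <= v E].

(* For a capacity [v] and [f] in [nonneg_measurable] the integrand is
   nonincreasing, so every [riemann_integral] over [0, b] with [0 <= b] exists,
   and these are nondecreasing in [b], so the limit exists as well. *)
Definition choquet v f : \bar R :=
  ext_riemann_integral (fun t => v [set x | t <= f x]).

Definition increasing_funs (f_ : nat -> T -> R) :=
  forall n x, f_ n x <= f_ n.+1 x.

Definition cvg_strongly_ae v (f_ : nat -> T -> R) f :=
  forall F, measurable F ->
    v [set x | F x /\ f_ n x @[n --> \oo] --> f x] = v F.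

Definition continuous_from_below v :=
  forall F : nat -> set T, (forall n, measurable (F n)) ->
    (forall n, F n `<=` F n.+1) ->
    v (F n) @[n --> \oo] --> v (\bigcup_n F n).

End Choquet.

(* Main.v *)
Require Import Defs.
From mathcomp Require Import all_boot all_order all_algebra.
From mathcomp Require Import all_classical all_reals all_analysis.
From mathcomp Require Import measurable_realfun ring lra.

Set Implicit Arguments.
Unset Strict Implicit.
Unset Printing Implicit Defensive.

Import Order.TTheory GRing.Theory Num.Theory.

(** Both implications rest on one description of the Choquet integral. The
    integrand [t |-> v {x | t <= f x}] is nonnegative and nonincreasing, and for
    such a function the extended Riemann integral is the supremum of the sums
    [right_sum g h n] = [h * (g h + g (2h) + ... + g (nh))] over all steps
    [h > 0] and lengths [n] ([ext_riemann_integral_right_sums]): no other lower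
    sums and no limit have to be considered.

    Continuity from below follows from monotone convergence applied to
    indicators, since the Choquet integral of the indicator of [A] is [v A]
    ([choquet_indic]).

    Conversely, let [f_n] increase to [f] strongly a.e., and let [C] be the set
    where [f_n x --> f x], which is measurable. Intersecting a set with [C] does
    not change its capacity, and on [C] one has [f_n <= f]; hence
    [v {t <= f_n} <= v {t <= f}], which bounds the integrals of the [f_n] by that
    of [f]. In the other direction, a point of [C] with [s < t <= f x] satisfies
    [s <= f_n x] for some [n], so continuity from below gives
    [v {t <= f} <= v (\bigcup_n {s <= f_n}) = lim_n v {s <= f_n}]
    ([limit_survival_le]). The loss from [t] to [s] is the reason why the
    integrands need not converge at every [t]. It is absorbed by shrinking the
    grid: for [r < 1], replacing the step [h] by [r * h] moves every grid point
    to the left and costs only the factor [r], so that [r] times a right sum for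
    [f] is at most the limit of the right sums for the [f_n] with step [r * h].
    Letting [r] tend to [1] gives the result
    ([choquet_monotone_convergence]). *)

Local Open Scope classical_set_scope.
Local Open Scope ring_scope.

(** * Uniqueness of the Riemann integral *)

Section RiemannIntegral.
Context {R : realType}.
Implicit Types (g : R -> R) (a b h : R) (n : nat).

Lemma exists_fine_partition a b (e : R) : a < b -> 0 < e ->
  exists2 s, itv_partition a b s & mesh_lt a s e.
Proof.
move=> ab e0; pose n := Num.truncn ((b - a) / e); pose h := (b - a) / n.+1%:R.
have h0 : 0 < h by rewrite divr_gt0 ?subr_gt0.
have he : h < e by rewrite ltr_pdivrMr // mulrC -ltr_pdivrMr // truncnS_gt.
pose s := mkseq (fun i => a + h * i.+1%:R) n.+1.
have ptE i : (i <= n.+1)%N -> partition_pt a s i = a + h * i%:R.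
  by case: i => [|i] ?; rewrite /partition_pt/= ?mulr0 ?addr0 // nth_mkseq.
have ss : size s = n.+1 by rewrite size_mkseq.
have step i : (i < size s)%N ->
    partition_pt a s i.+1 - partition_pt a s i = h.
  by rewrite ss => i_n; rewrite !ptE // ?(ltnW i_n) // -[i.+1%:R]natr1; ring.
exists s => [|i /step -> //]; split.
  apply/(pathP a) => i /step /eqP; rewrite subr_eq => /eqP.
  by rewrite /partition_pt /= => ->; rewrite ltrDr.
rewrite (last_nth a) ss; apply/eqP; transitivity (partition_pt a s n.+1) => //.
by rewrite ptE // /h divfK ?pnatr_eq0 // addrC subrK.
Qed.

Lemma is_riemann_integral_unique g a b (l1 l2 : R) : a < b ->
  is_riemann_integral g a b l1 -> is_riemann_integral g a b l2 -> l1 = l2.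
Proof.
move=> ab il1 il2; apply/eqP/negPn/negP => l12.
have e0 : 0 < `|l1 - l2| / 2 by rewrite divr_gt0 // normr_gt0 subr_eq0.
have [d1 d10 H1] := il1 _ e0; have [d2 d20 H2] := il2 _ e0.
have [|s sab sm] := @exists_fine_partition a b (Num.min d1 d2) ab.
  by rewrite lt_min d10.
have ts : Defs.tagged a s (partition_pt a s).
  move=> i si; rewrite lexx /=; case: sab => /(pathP a) /(_ i si) /ltW.
  by rewrite /partition_pt /=.
have [m1 m2] : mesh_lt a s d1 /\ mesh_lt a s d2.
  by split=> i /sm; rewrite lt_min => /andP[].
have := H1 _ _ sab m1 ts; have := H2 _ _ sab m2 ts; set S := riemann_sum _ _ _ _.
move=> S2 S1; have := ler_distD S l1 l2; rewrite (distrC l1 S).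
by move/le_lt_trans => /(_ _ (ltrD S1 S2)); rewrite -splitr ltxx.
Qed.

Lemma riemann_integralE g a b (l : R) : a < b ->
  is_riemann_integral g a b l -> riemann_integral g a b = l.
Proof.
move=> ab il; apply: (@is_riemann_integral_unique g a b) => //.
by rewrite /riemann_integral; apply: getPex; exists l.
Qed.

End RiemannIntegral.

(** * Riemann integrals of nonincreasing functions *)

Section Monotone.
Context {R : realType} (g : R -> R).
Hypothesis g_ni : nonincreasing_fun g.
Notation mu := (@lebesgue_measure R).

(** The Lebesgue integral serves only as an additive interval function squeezed
    between the rectangles of heights [g x] and [g y] ([primitive_bounds]); this
    dispenses with common refinements of partitions. *)
Definition primitive (b : R) : R := \int[mu]_(x in `[0, b]) g x.

Lemma nonincreasing_integrable (a b : R) : mu.-integrable `[a, b] (EFin \o g).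
Proof.
apply: measurable_bounded_integrable => //=.
- by rewrite lebesgue_measure_itv /=; case: ifP => _; rewrite -?EFinB ltry.
- exact: nonincreasing_measurable.
- exists (`|g a| + `|g b|); split; first exact: num_real.
  move=> M /ltW M1 x /=; rewrite in_itv/= => /andP[/g_ni gax /g_ni gxb].
  apply: le_trans M1; rewrite ler_norml.
  have := ler_norm (g a); have := ler_norm (- g b).
  have := normr_ge0 (g a); have := normr_ge0 (g b).
  by rewrite normrN; move: gax gxb; lra.
Qed.

Lemma primitive_bounds (x y : R) : 0 <= x -> x <= y ->
  g y * (y - x) <= primitive y - primitive x <= g x * (y - x).
Proof.
move=> x0 xy; rewrite /primitive Rintegral_itvB ?bnd_simp //; last first.
  exact: nonincreasing_integrable.
have muxy : fine (mu `]x, y]) = y - x.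
  rewrite lebesgue_measure_itv /= lte_fin; case: ltP => //= yx.
  by apply/esym/eqP; rewrite subr_eq0 eq_le xy yx.
have ig : mu.-integrable `]x, y] (EFin \o g).
  apply: integrableS (nonincreasing_integrable x y) => //.
  by apply: subset_itvr; rewrite bnd_simp.
have ic c : mu.-integrable `]x, y] (EFin \o (fun=> c)).
  apply: measurable_bounded_integrable => //=; last exact: bounded_cst.
  by rewrite lebesgue_measure_itv /=; case: ifP => _; rewrite -?EFinB ltry.
rewrite -muxy -!Rintegral_cst //.
apply/andP; split; apply: le_Rintegral => // z /=; rewrite in_itv/=.
- by move=> /andP[_]; exact: g_ni.
- by move=> /andP[/ltW + _]; exact: g_ni.
Qed.

(** On a cell of length at most [e] the sum and the primitive both lie between
    the two extreme rectangles, whose areas differ by at most [e] times the drop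
    of [g]; the drops telescope. *)
Lemma riemann_sum_error (x t : nat -> R) (e : R) n :
  (forall i, (i < n)%N -> 0 <= x i) ->
  (forall i, (i < n)%N -> x i <= t i <= x i.+1) ->
  (forall i, (i < n)%N -> x i.+1 - x i <= e) ->
  `|\sum_(0 <= i < n) g (t i) * (x i.+1 - x i) -
    (primitive (x n) - primitive (x 0%N))| <= e * (g (x 0%N) - g (x n)).
Proof.
move=> x0 xt xe.
rewrite -(@telescope_sumr _ 0%N n (fun i => primitive (x i))) // -sumrB.
have -> : e * (g (x 0%N) - g (x n)) =
    \sum_(0 <= i < n) e * (g (x i) - g (x i.+1)).
  have := @telescope_sumr _ 0%N n (fun i => - g (x i)) isT.
  rewrite opprK [RHS]addrC => <-; rewrite -mulr_sumr; congr (_ * _).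
  by apply: eq_bigr => i _; rewrite opprK addrC.
apply: le_trans (ler_norm_sum _ _ _) _.
rewrite !big_nat; apply: ler_sum => i /= i_n.
have /andP[xti txi] := xt _ i_n.
have /andP[lo hi] := primitive_bounds (x0 _ i_n) (le_trans xti txi).
have dx0 : 0 <= x i.+1 - x i by rewrite subr_ge0 (le_trans xti).
have := ler_wpM2r dx0 (g_ni xti); have := ler_wpM2r dx0 (g_ni txi).
have := ler_wpM2r (_ : 0 <= g (x i) - g (x i.+1)) (xe _ i_n).
rewrite subr_ge0 (g_ni (le_trans xti txi)) => /(_ isT).
rewrite ler_norml; move: lo hi; clear.
move: (g (t i)) (g (x i)) (g (x i.+1)) (x i.+1 - x i) (primitive _ - _).
by move=> gt gx gy dx dP; lra.
Qed.

Lemma is_riemann_integral_primitive (b : R) : 0 < b ->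
  is_riemann_integral g 0 b (primitive b).
Proof.
move=> b0 e e0; have gb : 0 <= g 0 - g b by rewrite subr_ge0 g_ni // ltW.
have den0 : 0 < g 0 - g b + 1 by lra.
(* Adding 1 keeps the denominator positive when [g] is constant on [0, b]. *)
exists (e / (g 0 - g b + 1)) => [|s t sb sm st]; first exact: divr_gt0.
have ptn : partition_pt 0 s (size s) = b by exact: itv_partition_nth_size sb.
have prim0 : primitive 0 = 0 by rewrite /primitive set_itv1 Rintegral_set1.
have := @riemann_sum_error (partition_pt 0 s) t (e / (g 0 - g b + 1)) (size s).
rewrite ptn /= {2}/partition_pt /= prim0 subr0 => H.
apply: le_lt_trans (H _ _ _) _ => //.
- move=> i si; rewrite /partition_pt (set_nth_default b) /= ?ltnS 1?ltnW //.
  by apply: itv_partition_nth_ge sb; rewrite ltnS ltnW.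
- by move=> i /sm /ltW.
- rewrite mulrAC ltr_pdivrMr // ltr_pM2l //; lra.
Qed.

(** * The extended Riemann integral as a supremum of sums over uniform grids *)

Definition right_sum (h : R) n : R := \sum_(0 <= i < n) g (h * i.+1%:R) * h.

Lemma grid_step (h : R) i : h * i.+1%:R - h * i%:R = h.
Proof. by rewrite -mulrBr -natrB // subSnn mulr1. Qed.

Lemma primitive0 : primitive 0 = 0.
Proof. by rewrite /primitive set_itv1 Rintegral_set1. Qed.

Lemma right_sum_le_primitive (h : R) n : 0 <= h ->
  right_sum h n <= primitive (h * n%:R).
Proof.
move=> h0; have := @telescope_sumr _ 0%N n (fun i => primitive (h * i%:R)) isT.
rewrite mulr0n mulr0 primitive0 subr0 => <-.
rewrite /right_sum !big_nat; apply: ler_sum => i _.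
have := @primitive_bounds (h * i%:R) (h * i.+1%:R).
rewrite grid_step mulr_ge0 // ler_wpM2l ?ler_nat //.
by move=> /(_ isT isT) /andP[].
Qed.

Lemma primitive_le_right_sum (h : R) n : 0 <= h ->
  primitive (h * n%:R) <= right_sum h n + h * (g 0 - g (h * n%:R)).
Proof.
move=> h0.
have := @riemann_sum_error (fun i => h * i%:R) (fun i => h * i.+1%:R) h n.
rewrite mulr0n mulr0 primitive0 subr0; under eq_bigr do rewrite grid_step.
move=> H; rewrite -lerBlDl; apply: le_trans (le_trans (ler_norm _) _) (H _ _ _).
- by rewrite distrC.
- by move=> i _; rewrite mulr_ge0.
- by move=> i _; rewrite lexx ler_wpM2l ?ler_nat.
- by move=> i _; rewrite grid_step.
Qed.

Hypothesis g_ge0 : forall x, 0 <= g x.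

Lemma primitive_nondecreasing : nondecreasing_fun primitive.
Proof.
move=> x y xy; case: (ltP x 0) => x0.
  rewrite {1}/primitive set_itv_ge ?bnd_simp -?ltNge // Rintegral_set0.
  exact: Rintegral_ge0.
have /andP[+ _] := primitive_bounds x0 xy.
rewrite -[primitive x <= _]subr_ge0; apply: le_trans.
by rewrite mulr_ge0 // subr_ge0.
Qed.

(** A right sum underestimates the integral over the interval that its grid
    covers, and for a fixed interval the error is at most the step times the drop
    of [g], which vanishes as the grid gets finer. *)
Lemma ext_riemann_integral_right_sums : ext_riemann_integral g =
  ereal_sup [set (right_sum hn.1 hn.2)%:E | hn in [set hn : R * nat | 0 < hn.1]].
Proof.
set S := ereal_sup _.
have cvgP : (primitive b)%:E @[b --> +oo] -->
    ereal_sup (range (EFin \o primitive)).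
  apply: nondecreasing_cvge => x y xy.
  by rewrite lee_fin primitive_nondecreasing.
have -> : ext_riemann_integral g = ereal_sup (range (EFin \o primitive)).
  apply/cvg_lim => //; apply: cvg_trans cvgP; apply: near_eq_cvg.
  near=> b; congr EFin; apply/esym/riemann_integralE => //.
  exact: is_riemann_integral_primitive.
apply/eqP; rewrite eq_le; apply/andP; split; apply: ge_ereal_sup.
(* The passage to [max 1 b] discards the upper bounds [b <= 0]. *)
- move=> _ [b _ <-]; apply: (@le_trans _ _ (primitive (Num.max 1 b))%:E).
    by rewrite lee_fin primitive_nondecreasing // le_max lexx orbT.
  have: 0 < Num.max 1 b by rewrite lt_max ltr01.
  move: (Num.max 1 b) => {}b b0; apply/lee_addgt0Pr => e e0.
  (* This [n] makes the error bound [h * (g 0 - g b)] at most [e]. *)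
  pose n := Num.truncn (b * (g 0 - g b) / e); pose h := b / n.+1%:R.
  have h0 : 0 < h by rewrite divr_gt0.
  have hn : h * n.+1%:R = b by rewrite divfK ?pnatr_eq0.
  apply: (@le_trans _ _ ((right_sum h n.+1)%:E + e%:E)%E).
    rewrite -EFinD lee_fin -{1}hn.
    apply: le_trans (primitive_le_right_sum _ (ltW h0)) _.
    rewrite lerD2l hn /h mulrAC ler_pdivrMr // [leRHS]mulrC -ler_pdivrMr //.
    exact/ltW/truncnS_gt.
  by rewrite leeD2r //; apply: ereal_sup_ubound; exists (h, n.+1).
- move=> _ [[h n] /= h0 <-]; apply: (@le_trans _ _ (primitive (h * n%:R))%:E).
    by rewrite lee_fin right_sum_le_primitive // ltW.
  by apply: ereal_sup_ubound; exists (h * n%:R).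
Unshelve. all: by end_near. Qed.

End Monotone.

Lemma cvg_right_sum {R : realType} (u : nat -> R -> R) (l : R -> R) (h : R) n :
  (forall i, u k (h * i.+1%:R) @[k --> \oo] --> l (h * i.+1%:R)) ->
  right_sum (u k) h n @[k --> \oo] --> right_sum l h n.
Proof.
move=> ul; apply: cvg_big => [|i _]; first exact: add_continuous.
exact: cvgMr_tmp.
Qed.

(** * The Choquet integral *)

Section Choquet.
Context {R : realType} {d : measure_display} {T : measurableType d}.
Context {v : set T -> R}.
Hypothesis hv : capacity v.

Definition survival (f : T -> R) (t : R) : R := v [set x | t <= f x].

Lemma capacity_ge0 E : measurable E -> 0 <= v E.
Proof. by case: hv => + _ _; apply. Qed.

Lemma capacity0 : v set0 = 0.
Proof. by case: hv. Qed.

Lemma le_capacity E F : measurable E -> measurable F -> F `<=` E -> v F <= v E.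
Proof. by case: hv => _ _; apply. Qed.

Lemma measurable_superlevel (f : T -> R) (t : R) :
  measurable_fun setT f -> measurable [set x | t <= f x].
Proof.
move=> mf; rewrite -[X in measurable X]setTI.
exact: measurable_fun_le (measurable_cst _) mf.
Qed.

Section Function.
Variable f : T -> R.
Hypothesis mf : measurable_fun setT f.

Lemma survival_nonincreasing : nonincreasing_fun (survival f).
Proof.
move=> s t st; apply: le_capacity; [exact: measurable_superlevel..|].
by move=> x /=; apply: le_trans.
Qed.

Lemma survival_ge0 t : 0 <= survival f t.
Proof. exact/capacity_ge0/measurable_superlevel. Qed.

Lemma choquetE : choquet v f =
  ereal_sup [set (right_sum (survival f) hn.1 hn.2)%:E
            | hn in [set hn : R * nat | 0 < hn.1]].
Proof.
apply: ext_riemann_integral_right_sums; [exact: survival_nonincreasing|].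
exact: survival_ge0.
Qed.

Lemma right_sum_le_choquet (h : R) n : 0 < h ->
  ((right_sum (survival f) h n)%:E <= choquet v f)%E.
Proof.
by move=> h0; rewrite choquetE; apply: ereal_sup_ubound; exists (h, n).
Qed.

Lemma choquet_le (M : \bar R) :
  (forall (h : R) n, 0 < h -> ((right_sum (survival f) h n)%:E <= M)%E) ->
  (choquet v f <= M)%E.
Proof.
move=> H; rewrite choquetE; apply: ge_ereal_sup => _ [[h n] /= h0 <-].
exact: H.
Qed.

End Function.

Lemma le_choquet (f1 f2 : T -> R) :
  measurable_fun setT f1 -> measurable_fun setT f2 ->
  (forall t, survival f1 t <= survival f2 t) ->
  (choquet v f1 <= choquet v f2)%E.
Proof.
move=> mf1 mf2 f12; apply: choquet_le => // h n h0.
apply: le_trans (right_sum_le_choquet mf2 n h0); rewrite lee_fin.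
by apply: ler_sum => i _; rewrite ler_wpM2r // ltW.
Qed.

(** The integrand is [v A] on ]0, 1] and [0] beyond [1]; its value [v setT] at
    [0] is never sampled, because the grids of right sums start at [h > 0]. *)
Lemma choquet_indic A : measurable A -> choquet v \1_A = (v A)%:E.
Proof.
move=> mA.
have mI : measurable_fun setT (\1_A : T -> R) by exact: measurable_indic.
have lo t : 0 < t -> t <= 1 -> survival \1_A t = v A.
  move=> t0 t1; congr v; apply/seteqP; split=> x /=; rewrite indicE.
    case: (boolP (x \in A)) => [/set_mem//|_] /= /(lt_le_trans t0).
    by rewrite ltxx.
  by move=> /mem_set ->.
have hi t : 1 < t -> survival \1_A t = 0.
  move=> t1; rewrite -capacity0; congr v; apply/seteqP; split=> x //=.
  rewrite indicE => /(lt_le_trans t1); case: (_ \in _) => /=; lra.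
apply/eqP; rewrite eq_le; apply/andP; split; last first.
  apply: le_trans (right_sum_le_choquet mI 1 ltr01).
  by rewrite /right_sum big_nat1 !mulr1 lo.
apply: choquet_le => // h n h0; rewrite lee_fin.
have vA := capacity_ge0 mA.
(* This sharper bound is the one that is preserved when [n] grows. *)
suff H : right_sum (survival \1_A) h n <= v A * Num.min 1 (h * n%:R).
  by apply: le_trans H _; rewrite ler_piMr // ge_min lexx.
elim: n => [|n IH].
  by rewrite /right_sum big_nil mulr_ge0 // le_min ler01 mulr_ge0 // ltW.
have hn : h * n.+1%:R = h * n%:R + h by rewrite -natr1 mulrDr mulr1.
rewrite /right_sum big_nat_recr //= -/(right_sum _ h n).
case: (leP (h * n.+1%:R) 1) => hn1.
  rewrite lo ?mulr_gt0 // min_r // in IH *; last by rewrite hn in hn1; lra.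
  by rewrite hn mulrDr lerD2r.
rewrite hi // mul0r addr0 mulr1.
by apply: le_trans IH _; rewrite ler_piMr // ge_min lexx.
Qed.

(** * Monotone convergence *)

Section Convergence.
Variables (f_ : nat -> T -> R) (f : T -> R).
Hypothesis mf_ : forall n, measurable_fun setT (f_ n).
Hypothesis mf : measurable_fun setT f.
Hypothesis incf : increasing_funs f_.

Lemma increasing_funs_homo (x : T) : nondecreasing_seq (f_ ^~ x).
Proof. by apply/nondecreasing_seqP => n; apply: incf. Qed.

Lemma cvg_le_limit (x : T) : f_ n x @[n --> \oo] --> f x -> forall n, f_ n x <= f x.
Proof.
move=> cfx n; rewrite -(cvg_lim _ cfx) //.
apply: nondecreasing_cvgn_le (increasing_funs_homo x) _ n.
by apply/cvg_ex; exists (f x).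
Qed.

(** Monotonicity of a capacity is available only between measurable sets, so the
    set of convergence has to be measurable. As [f_] increases, convergence to
    [f x] means that [f_ n x] stays below [f x] and gets within each
    [k.+1%:R^-1] of it. *)
Lemma measurable_cvg_set : measurable [set x : T | f_ n x @[n --> \oo] --> f x].
Proof.
rewrite [X in measurable X](_ : _ =
  (\bigcap_n [set x : T | f_ n x <= f x]) `&`
  \bigcap_k \bigcup_n [set x : T | f x - k.+1%:R^-1 <= f_ n x]); last first.
  apply/seteqP; split=> x /=.
    move=> cfx; split=> [n _ /=|k _]; first exact: cvg_le_limit.
    have /filter_ex[n fn] : \forall n \near \oo, f x - k.+1%:R^-1 <= f_ n x.
      by apply: cvgr_ge cfx _ _; rewrite ltrBlDr ltrDl invr_gt0.
    by exists n.
  move=> [le_f ge_f]; apply/cvgrPdist_le => e e0.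
  have [k ke] := filter_ex (near_infty_natSinv_lt (PosNum e0)).
  have [N _ /= fN] := ge_f k I; exists N => // n /= Nn.
  rewrite ger0_norm ?subr_ge0; last exact: le_f.
  rewrite lerBlDr -lerBlDl (le_trans _ (increasing_funs_homo x Nn)) //.
  by rewrite (le_trans _ fN) // lerD2l lerN2 ltW.
apply: measurableI.
  apply: bigcapT_measurable => n; rewrite -[X in measurable X]setTI.
  exact: measurable_fun_le.
apply: bigcapT_measurable => k; apply: bigcupT_measurable => n.
rewrite -[X in measurable X]setTI; apply: measurable_fun_le => //.
exact: measurable_funB.
Qed.

Hypothesis cvgf : cvg_strongly_ae v f_ f.

(** The inequality [f_ n <= f] may fail off the set of convergence, but that part
    of a superlevel set carries no capacity. *)
Lemma survival_le_limit n t : survival (f_ n) t <= survival f t.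
Proof.
have mS := measurable_superlevel t (mf_ n).
rewrite /survival -(cvgf mS); apply: le_capacity.
- exact: measurable_superlevel.
- exact: measurableI measurable_cvg_set.
- by move=> x /= [tf /cvg_le_limit/(_ n)]; apply: le_trans.
Qed.

(** The strict inequality [s < t] is needed: a point where the [f_ n x] approach
    [f x = t] without reaching it lies in no superlevel set of the [f_ n] at
    level [t]. *)
Lemma limit_survival_le s t : s < t ->
  survival f t <= v (\bigcup_n [set x : T | s <= f_ n x]).
Proof.
move=> st; have mS := measurable_superlevel t mf.
rewrite /survival -(cvgf mS); apply: le_capacity.
- by apply: bigcupT_measurable => n; exact: measurable_superlevel.
- exact: measurableI measurable_cvg_set.
move=> x /= [tf cfx].
have /filter_ex[n sfn] : \forall n \near \oo, s <= f_ n x.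
  exact: cvgr_ge cfx _ (lt_le_trans st tf).
by exists n.
Qed.

Lemma choquet_nondecreasing : nondecreasing_seq (choquet v \o f_).
Proof.
move=> m n mn; apply: le_choquet => // t; apply: le_capacity.
- exact: measurable_superlevel.
- exact: measurable_superlevel.
- by move=> x /= /le_trans; apply; apply: increasing_funs_homo.
Qed.

(** The level [t] of [f] is compared with the smaller level [r * t] of the
    [f_ n]; on right sums this amounts to rescaling the step by [r]. *)
Lemma choquet_monotone_convergence : continuous_from_below v ->
  choquet v (f_ n) @[n --> \oo] --> choquet v f.
Proof.
move=> cv; have := ereal_nondecreasing_cvgn choquet_nondecreasing.
set S := ereal_sup _; suff -> : choquet v f = S by [].
apply/eqP; rewrite eq_le; apply/andP; split; last first.
  apply: ge_ereal_sup => _ [n _ <-]; apply: le_choquet => // t.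
  exact: survival_le_limit.
apply: choquet_le => // h n h0.
apply/lee_mul01Pr => [|r /andP[r0 r1]].
  by rewrite lee_fin sumr_ge0 // => i _; rewrite mulr_ge0 ?survival_ge0 // ltW.
have rh0 : 0 < r * h by rewrite mulr_gt0.
pose B s := v (\bigcup_k [set x : T | s <= f_ k x]).
have cvgB s : survival (f_ k) s @[k --> \oo] --> B s.
  apply: (cv (fun k => [set x : T | s <= f_ k x])) => k.
    exact: measurable_superlevel.
  by move=> x /= /le_trans; apply; exact: incf.
apply: (@le_trans _ _ (right_sum B (r * h) n)%:E).
  rewrite -EFinM lee_fin mulr_sumr; apply: ler_sum => i _.
  rewrite mulrCA ler_wpM2r ?(ltW rh0) //; apply: limit_survival_le.
  by rewrite -mulrA gtr_pMl ?mulr_gt0.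
have : (right_sum (survival (f_ k)) (r * h) n)%:E @[k --> \oo] -->
    (right_sum B (r * h) n)%:E.
  by apply: cvg_EFin; [exact: nearW|apply: cvg_right_sum => i; exact: cvgB].
move=> /cvge_to_le; apply; apply: nearW => k.
apply: le_trans (right_sum_le_choquet (mf_ k) n rh0) _.
by apply: ereal_sup_ubound; exists k.
Qed.

End Convergence.

Lemma cvg_indic_bigcup (F : nat -> set T) x : (forall n, F n `<=` F n.+1) ->
  (\1_(F n) x : R) @[n --> \oo] --> (\1_(\bigcup_n F n) x : R).
Proof.
move=> ndF; apply: cvg_near_cst.
have [[N _ FN]|nF] := pselect ((\bigcup_n F n) x).
  exists N => // n /= Nn; rewrite !indicE !mem_set //; first by exists N.
  elim: n Nn => [|n IH]; first by rewrite leqn0 => /eqP <-.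
  by rewrite leq_eqVlt => /predU1P[<- //|/IH /ndF].
apply: nearW => n; rewrite !indicE !memNset // => Fn.
by apply: nF; exists n.
Qed.

End Choquet.

Theorem theorem2 (R : realType) (d : measure_display) (T : measurableType d)
    (v : set T -> R) (hv : capacity v) :
  (forall (f_ : nat -> T -> R) (f : T -> R),
      (forall n, nonneg_measurable (f_ n)) -> nonneg_measurable f ->
      increasing_funs f_ -> cvg_strongly_ae v f_ f ->
      choquet v (f_ n) @[n --> \oo] --> choquet v f)
  <-> continuous_from_below v.
Proof.
split=> [mct F mF ndF|cv f_ f mf_ [mf _] incf cvgf]; last first.
  by apply: choquet_monotone_convergence => // n; have [] := mf_ n.
have mU : measurable (\bigcup_n F n) by exact: bigcupT_measurable.
have nnm A : measurable A -> nonneg_measurable (\1_A : T -> R).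
  by move=> mA; split=> [|x]; [exact: measurable_indic|rewrite indicE ler0n].
have /fine_cvg : choquet v (\1_(F n)) @[n --> \oo] --> (v (\bigcup_n F n))%:E.
  rewrite -choquet_indic //; apply: (mct (fun n => \1_(F n))) => [n|||A _].
  - exact/nnm/mF.
  - exact: nnm.
  - move=> n x; rewrite !indicE ler_nat.
    by case: (boolP (x \in F n)) => // /set_mem /ndF /mem_set ->.
  - congr v; apply/seteqP; split=> x /= => [[]//|Ax]; split=> //.
    exact: cvg_indic_bigcup.
apply: cvg_trans; apply: near_eq_cvg; apply: nearW => n /=.
by rewrite choquet_indic.
Qed.
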